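(* Consider the finite horizon discounted expected cost transmission scheduling problem with a single receiver, linear power-rate curves, i.i.d. channel conditions, linear holding costs, and with $P/c_s$ an integer multiple of $d$ for every $s\in\mathcal S$, as described in the context. For $s\in\mathcal{S}$ let $p(s)$ be the probability that the channel is in state $s$ in a time slot, and let $L(s):=\frac{P}{d\cdot c_s}$. Define the thresholds $\gamma_{n,j}$ for $n\in\{1,2,\ldots,N\}$ and $j\in\mathbb{N}$ recursively as follows: (i) if $j=1$, $\gamma_{n,j}=\infty$; (ii) if $j>n$, $\gamma_{n,j}=0$ (for $j\geq 2$); (iii) if $2\le j\le n$, $$\gamma_{n,j}=-h+\alpha\cdot\Biggl(\sum_{s:\,c_s\ge\gamma_{n-1,j-1}}p(s)\,\gamma_{n-1,j-1}+\sum_{s:\,c_s<\gamma_{n-1,j-1}}p(s)\,c_s+\sum_{s:\,c_s<\gamma_{n-1,j-1+L(s)}}p(s)\bigl[\gamma_{n-1,j-1+L(s)}-c_s\bigr]\Biggr).$$ For each $n\in\{1,2,\ldots,N\}$ and $s\in\mathcal{S}$, if $\gamma_{n,j+1}\le c_s<\gamma_{n,j}$, define $b_n(s):=j\cdot d$. Then the optimal control strategy is given by $\boldsymbol{\pi}^*=\{y_N^*,y_{N-1}^*,\ldots,y_1^*\}$, where $$y_n^*(x,s):=\begin{cases}x,&\text{if }x\ge b_n(s),\\ b_n(s),&\text{if }b_n(s)-\frac{P}{c_s}\le x<b_n(s),\\ x+\frac{P}{c_s},&\text{if }x<b_n(s)-\frac{P}{c_s},\end{cases}$$ is the buffer level after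 transmission (and before playout) in slot $n$ when the state is $(x,s)$.
   Context: Time is discrete and indexed backwards: $n=N,N-1,\ldots,1$ is the number of slots remaining in a horizon of length $N\in\mathbb{N}$. The channel conditions $S_N,S_{N-1},\ldots,S_1$ are independent and identically distributed on a finite set $\mathcal{S}$, and unaffected by scheduling decisions. Transmitting $r\ge0$ packets (a real number) under channel condition $s$ consumes power $c_s\cdot r$ with $c_s>0$. $P>0$ is the power available per slot and $d>0$ is the number of packets removed from the receiver buffer at the end of each slot. For each $s\in\mathcal{S}$, $\frac{P}{c_s}=l\cdot d$ for some $l\in\mathbb{N}=\{1,2,\ldots\}$ (depending on $s$). The holding cost function is linear: $h(x)=h\cdot x$ for a constant $h\ge0$. The discount factor is $\alpha\in[0,1]$. At the beginning of slot $n$ the scheduler observes the buffer level $X_n=x\ge0$ and the channel condition $S_n=s$ and chooses the number of packets $Z_n=z$ to transmit, subject to $z\ge\max(0,d-x)$ (no underflow) and $c_s z\le P$ (power constraint). Then $X_{n-1}=X_n+Z_n-d$. The buffer is empty at the beginning of the horizon: $X_N=0$. The problem is to minimize $\mathbb{E}\bigl[\sum_{t=1}^N\alpha^{N-t}\{c_{S_t}Z_t+h\cdot(X_t+Z_t-d)\}\bigr]$ over all history-dependent randomized and deterministic policies. A strategy $\{y_N,\ldots,y_1\}$ expressed through buffer levels after transmission transmits $Z_n=y_n(X_n,S_n)-X_n$ packets in slot $n$. *)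

(* Defs.v *)
From HB Require Import structures.
From mathcomp Require Import all_boot all_order all_algebra.
From mathcomp Require Import all_classical all_reals all_analysis.
Import Order.TTheory GRing.Theory Num.Theory.
Import numFieldNormedType.Exports.

Set Implicit Arguments.
Unset Strict Implicit.
Unset Printing Implicit Defensive.

Local Open Scope classical_set_scope.
Local Open Scope ring_scope.

(* The joint law of (x, y) where x has law mu and, given x, y has law k x. *)
Section joint.
Context {d1 d2 : measure_display} {T1 : measurableType d1}
  {T2 : measurableType d2} {R : realType}.
Variables (mu : probability T1 R) (k : R.-pker T1 ~> T2).

Definition joint (A : set (T1 * T2)) : \bar R :=
  (\int[mu]_x \int[k x]_y (\1_A (x, y))%:E)%E.

Let mu_cst :
  measurable_fun [set: unit] (fun=> mu : pprobability T1 R).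
Proof. exact: measurable_cst. Qed.

Let joint_kproduct :
  joint = kproduct (kprobability mu_cst) (kernel.kernel_snd k) tt.
Proof. by []. Qed.

Let joint0 : joint set0 = 0%E.
Proof. by rewrite joint_kproduct measure0. Qed.

Let joint_ge0 A : (0 <= joint A)%E.
Proof. by rewrite joint_kproduct measure_ge0. Qed.

Let joint_sigma_additive : semi_sigma_additive joint.
Proof. by rewrite joint_kproduct; exact: semi_sigma_additive_kproduct. Qed.

HB.instance Definition _ :=
  isMeasure.Build _ _ _ joint joint0 joint_ge0 joint_sigma_additive.

Let joint_setT : joint setT = 1%E.
Proof.
rewrite /joint (eq_integral (cst 1%E)) => [|x _]; last first.
  rewrite (eq_integral (cst 1%E)) => [|y _]; last by rewrite indicT.
  by rewrite integral_cst// mul1e prob_kernel.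
by rewrite integral_cst// mul1e; exact: probability_setT.
Qed.

HB.instance Definition _ := Measure_isProbability.Build _ _ _ joint joint_setT.

Definition joint_law : probability (T1 * T2)%type R := joint.

End joint.

(* Slots are counted by n = number of slots remaining, from N down to 1, whereas
   histories are indexed by k = number of slots elapsed: the decision taken
   after a history in [hist k] is that of slot n = N - k.  A history records the
   past pairs (S_t, Z_t); past buffer levels are not recorded because, with
   X_N = 0, they are determined by the past transmissions. *)
Section histories.
Context {dS : measure_display} (S : measurableType dS) (R : realType).

Fixpoint hist_display (k : nat) : measure_display :=
  if k is k'.+1 then
    measure_prod_display
      (measure_prod_display (hist_display k', dS), default_measure_display)
  else default_measure_display.

Fixpoint hist (k : nat) : measurableType (hist_display k) :=
  if k is k'.+1 then (hist k' * S * R)%type : measurableType _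
  else unit : measurableType _.

(* A history-dependent randomized policy: the law of Z_{N-k} given the past and
   the channel condition S_{N-k}.  Deterministic policies are the ones whose
   kernels are Dirac masses. *)
Definition policy := forall k : nat, R.-pker (hist k * S)%type ~> R.

End histories.

Section scheduling.
Context {dS : measure_display} {S : measurableType dS} {R : realType}.
Variables (p : probability S R) (c : S -> R) (P d h alpha : R) (N : nat).

(* The buffer level X_{N-k}. *)
Fixpoint buffer (k : nat) : hist S R k -> R :=
  if k is k'.+1 then fun w : hist S R k' * S * R => buffer w.1.1 + w.2 - d
  else fun=> 0.

Definition feasible (x : R) (s : S) : set R :=
  [set z | Num.max 0 (d - x) <= z /\ c s * z <= P].

Fixpoint feasible_hist (k : nat) : hist S R k -> Prop :=
  if k is k'.+1 then fun w : hist S R k' * S * R =>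
    feasible_hist w.1.1 /\ feasible (buffer w.1.1) w.1.2 w.2
  else fun=> True.

Definition admissible (pi : policy S R) : Prop :=
  forall (k : nat) (w : hist S R k) (s : S),
    (k < N)%N -> feasible_hist w ->
    pi k (w, s) (feasible (buffer w) s) = 1%E.

(* The law of (S_N, Z_N, ..., S_{N-k+1}, Z_{N-k+1}) under pi: each channel
   condition has law p and is independent of the past. *)
Fixpoint law (pi : policy S R) (k : nat) : probability (hist S R k) R :=
  match k return probability (hist S R k) R with
  | 0%N => \d_tt
  | k'.+1 => joint_law ((law pi k' \x p)%E : probability (hist S R k' * S)%type R) (pi k')
  end.

(* The discounted cost of the first k slots; for t = N - k, the discount
   factor alpha^(N-t) is alpha^k. *)
Fixpoint cost (k : nat) : hist S R k -> R :=
  if k is k'.+1 then fun w : hist S R k' * S * R =>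
    let: (w', s, z) := w in
    cost w' + alpha ^+ k' * (c s * z + h * (buffer w' + z - d))
  else fun=> 0.

Definition expected_cost (pi : policy S R) : \bar R := 'E_(law pi N)[@cost N].

Definition optimal (pi : policy S R) : Prop :=
  admissible pi /\
  forall pi' : policy S R, admissible pi' ->
    (expected_cost pi <= expected_cost pi')%E.

(* pi transmits y_n(X_n, S_n) - X_n packets in slot n. *)
Definition follows (pi : policy S R) (y : nat -> R -> S -> R) : Prop :=
  forall (k : nat) (w : hist S R k) (s : S), (k < N)%N ->
    pi k (w, s) [set y (N - k)%N (buffer w) s - buffer w] = 1%E.

(* The integer P / (d c_s): the truncation is harmless when P / c_s is an
   integer multiple of d. *)
Definition L (s : S) : nat := Num.truncn (P / (d * c s)).

(* The value at j = 0, which is never used, is junk. *)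
Fixpoint gamma (n j : nat) : \bar R :=
  if (j <= 1)%N then +oo%E
  else if (n < j)%N then 0%E
  else if n is n'.+1 then
    (- h%:E + alpha%:E *
      ( \sum_(s \in [set s | gamma n' j.-1 <= (c s)%:E])
           p [set s] * gamma n' j.-1
      + \sum_(s \in [set s | (c s)%:E < gamma n' j.-1]) p [set s] * (c s)%:E
      + \sum_(s \in [set s | (c s)%:E < gamma n' (j.-1 + L s)%N])
           p [set s] * (gamma n' (j.-1 + L s)%N - (c s)%:E)))%E
  else 0%E.

Definition in_band (n : nat) (s : S) (j : nat) : Prop :=
  (1 <= j)%N /\ (gamma n j.+1 <= (c s)%:E < gamma n j)%E.

Definition ystar (b : nat -> S -> R) (n : nat) (x : R) (s : S) : R :=
  if b n s <= x then x
  else if b n s - P / c s <= x then b n s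
  else x + P / c s.

End scheduling.

(* Main.v *)
(* By backward induction the optimal cost-to-go is piecewise affine in the buffer
   level, with breakpoints at the multiples of d and nondecreasing slopes.  In
   slot n the cost of ending it with t packets in the buffer, c_s t plus holding
   cost plus discounted cost-to-go, is therefore convex in t, and the best
   feasible t is the projection of its minimizer onto the feasible interval,
   which is what y*_n does.  The threshold gamma_{n,i+2}, for i + 2 <= n, is
   minus the slope on [i d, (i+1) d] of all of this cost but c_s t; for
   i + 2 > n that slope is nonnegative, so truncating the threshold to 0 does not
   change its comparisons with c_s > 0.  For histories, the cost so far plus the
   discounted optimal cost-to-go has nondecreasing expectation under every
   admissible policy, and constant expectation under y*. *)

Require Import Defs.
From mathcomp Require Import all_boot all_order all_algebra.
From mathcomp Require Import all_classical all_reals all_analysis.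
From mathcomp Require Import finmap measurable_realfun ring lra.
Import Order.TTheory GRing.Theory Num.Theory.
Import numFieldNormedType.Exports.

Set Implicit Arguments.
Unset Strict Implicit.
Unset Printing Implicit Defensive.

Local Open Scope classical_set_scope.
Local Open Scope ring_scope.

(** * Functions that are affine on each cell of the grid of multiples of [d] *)

Section grid_affine.
Context {R : realType}.
Implicit Types (f : R -> R) (d x y : R) (sigma : nat -> R).

(** Only increments within closed cells are prescribed: no intercepts are needed, and since
    neighbouring cells share an endpoint, increments across several cells add up. *)
Definition grid_affine d f sigma := forall i x y,
  i%:R * d <= x -> x <= y -> y <= i.+1%:R * d -> f y - f x = sigma i * (y - x).

Lemma grid_cell d x : 0 < d -> 0 <= x ->
  exists i : nat, i%:R * d <= x <= i.+1%:R * d.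
Proof.
move=> d0 x0; exists (Num.truncn (x / d)).
have /andP[] := truncn_itv (divr_ge0 x0 (ltW d0)).
by rewrite ler_pdivlMr// ltr_pdivrMr// => -> /ltW.
Qed.

Lemma grid_affine_noninc d f sigma k : grid_affine d f sigma ->
  (forall i, (i < k)%N -> sigma i <= 0) ->
  forall x y, 0 <= x -> x <= y -> y <= k%:R * d -> f y <= f x.
Proof.
move=> fS; elim: k => [_ x y x0 xy|k IH sle0 x y x0 xy yk].
  by rewrite mul0r => y0; have -> : y = x by lra.
have IHk := IH (fun i ik => sle0 i (ltnW ik)).
have step u v : k%:R * d <= u -> u <= v -> v <= k.+1%:R * d -> f v <= f u.
  move=> ku uv vk; rewrite -subr_le0 (fS k)//.
  by rewrite mulr_le0_ge0 ?sle0// subr_ge0.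
have [yk'|/ltW ky] := leP y (k%:R * d); first exact: IHk.
have [kx|/ltW xk] := leP (k%:R * d) x; first exact: step.
by apply: (le_trans (step _ _ _ ky yk)); rewrite ?lexx// IHk.
Qed.

Lemma grid_affine_nondec d f sigma k : 0 < d -> grid_affine d f sigma ->
  (forall i, (k <= i)%N -> 0 <= sigma i) ->
  forall x y, k%:R * d <= x -> x <= y -> f x <= f y.
Proof.
move=> d0 fS sge0 x y kx xy.
(* Finitely many cells separate [y] from [k%:R * d]; the induction is on a bound for their
   number. *)
have [m ym] : exists m : nat, y <= (k + m)%:R * d.
  have y0 : 0 <= y by apply: le_trans xy; apply: le_trans kx; rewrite mulr_ge0// ltW.
  have [i /andP[_ yi]] := grid_cell d0 y0; exists i.+1; apply: le_trans yi _.
  by rewrite ler_pM2r// ler_nat leq_addl.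
elim: m => [|m IH] in y xy ym *.
  by rewrite addn0 in ym; have -> : y = x by lra.
have step u v : (k + m)%:R * d <= u -> u <= v -> v <= (k + m).+1%:R * d ->
    f u <= f v.
  move=> ku uv vk; rewrite -subr_ge0 (fS (k + m)%N)//.
  by rewrite mulr_ge0 ?sge0 ?leq_addr// subr_ge0.
rewrite addnS in ym.
have [yk'|/ltW ky] := leP y ((k + m)%:R * d); first exact: IH.
have [kx'|/ltW xk] := leP ((k + m)%:R * d) x; first exact: step.
by apply: le_trans (step _ _ _ ky ym); rewrite ?lexx// IH.
Qed.

End grid_affine.

(** * The slope recursion and the index where the slopes cross [- c s] *)

Section slopes.
Context {S : Type} {R : realType}.
Variables (e : seq S) (q c : S -> R) (L : S -> nat) (h alpha : R).

(* Slope of the optimal cost-to-go from n slots on, as a function of the buffer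
   level, on the cell [i d, (i+1) d].  Channel s contributes - c s where the
   target is reached, clamped by the slopes met when nothing is transmitted and
   when L s * d packets are. *)
Fixpoint value_slope (n i : nat) : R :=
  if n is n'.+1 then
    \sum_(s <- e) q s *
      Num.min (h + alpha * value_slope n' (i + L s).-1)
        (if i is i'.+1 then Num.max (- c s) (h + alpha * value_slope n' i')
         else - c s)
  else 0.

(* Slope in slot n of the holding cost plus the discounted cost-to-go, as a
   function of the buffer level after playout. *)
Definition next_slope (n i : nat) : R := h + alpha * value_slope n.-1 i.

Lemma value_slopeS n i : value_slope n.+1 i =
  \sum_(s <- e) q s * Num.min (next_slope n.+1 (i + L s).-1)
    (if i is i'.+1 then Num.max (- c s) (next_slope n.+1 i') else - c s).
Proof. by case: i. Qed.

Hypotheses (q_ge0 : forall s, 0 <= q s) (L_gt0 : forall s, (0 < L s)%N).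
Hypotheses (h_ge0 : 0 <= h) (alpha_ge0 : 0 <= alpha).

(** Convexity of the cost-to-go. Minima, maxima and nonnegative combinations preserve monotonicity,
    and the value [- c s] used at [i = 0] is a lower bound of the maximum used at larger [i]. *)
Lemma value_slope_nondec n : {homo value_slope n : i j / (i <= j)%N >-> i <= j}.
Proof.
elim: n => [i j _|n IH i j ij] /=; first exact: lexx.
have hom i' j' : (i' <= j')%N ->
    h + alpha * value_slope n i' <= h + alpha * value_slope n j'.
  by move=> ij'; rewrite lerD2l ler_wpM2l// IH.
apply: ler_sum => s _; rewrite ler_wpM2l//.
rewrite le_min !ge_min hom/=; last by rewrite -!subn1 leq_sub2r// leq_add2r.
case: j i ij => [|j] [|i]//= ij; rewrite ?lexx ?orbT//; apply/orP; right.
  by rewrite le_max lexx.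
by rewrite ge_max !le_max lexx/= hom// orbT.
Qed.

Lemma next_slope_nondec n : {homo next_slope n : i j / (i <= j)%N >-> i <= j}.
Proof. by move=> i j ij; rewrite lerD2l ler_wpM2l// value_slope_nondec. Qed.

(** A buffer of [n * d] packets already covers the playout of all remaining slots, so further
    packets only incur holding cost. Formally, one step of the recursion lowers the index by at most
    one. *)
Lemma value_slope_ge0 n i : (n <= i)%N -> 0 <= value_slope n i.
Proof.
elim: n i => //= n IH [//|i] ni; apply: sumr_ge0 => s _.
have ns j : (n <= j)%N -> 0 <= h + alpha * value_slope n j.
  by move=> nj; rewrite addr_ge0// mulr_ge0// IH.
rewrite mulr_ge0// le_min le_max !ns ?orbT//.
by rewrite addSn/=; apply: leq_trans (leq_addr _ _).
Qed.

Lemma next_slope_ge0 n i : (n <= i.+1)%N -> 0 <= next_slope n i.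
Proof.
by move=> ni; rewrite addr_ge0// mulr_ge0// value_slope_ge0//; case: n ni.
Qed.

(** With [c s] added, the slopes change sign at [k], so [k * d] is the best level after playout and
    [k.+1 * d] the target before playout. *)
Definition switch (n : nat) (s : S) (k : nat) : Prop :=
  (forall i, (i < k)%N -> next_slope n i < - c s) /\
  (forall i, (k <= i)%N -> - c s <= next_slope n i).

(** The slopes are eventually nonnegative, hence at least [- c s]; the first index where this
    happens works by monotonicity. *)
Lemma switch_exists n s : 0 < c s -> exists k, switch n s k.
Proof.
move=> c0.
have ex : exists i, - c s <= next_slope n i.
  by exists n; rewrite (@le_trans _ _ 0) ?next_slope_ge0// oppr_le0 ltW.
case: (ex_minnP ex) => k kP kmin; exists k; split=> i ik.
  by rewrite ltNge; apply/negP => /kmin; rewrite leqNgt ik.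
by rewrite (le_trans kP)// next_slope_nondec.
Qed.

Lemma switch_uniq n s k k' : switch n s k -> switch n s k' -> k = k'.
Proof.
move=> [k1 k2] [k1' k2']; case: (ltngtP k k') => // lt.
  by have := k1' _ lt; rewrite ltNge k2.
by have := k1 _ lt; rewrite ltNge k2'.
Qed.

End slopes.

(** * The cost-to-go of [y*]: its slopes and its one-step optimality *)

Section value.
Context {dS : measure_display} {S : measurableType dS} {R : realType}.
Variables (e : seq S) (q c : S -> R) (L : S -> nat) (P d h alpha : R).
Variable b : nat -> S -> R.

Local Notation y := (ystar c P b).

(** This is the cost of following [y*], not a minimum over decisions; that no decision does better
    is the content of [ystar_optimal]. *)
Fixpoint value (n : nat) (x : R) : R :=
  if n is n'.+1 then
    \sum_(s <- e) q s *
      (c s * (y n x s - x) + h * (y n x s - d) + alpha * value n' (y n x s - d))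
  else 0.

Hypotheses (q_ge0 : forall s, 0 <= q s) (L_gt0 : forall s, (0 < L s)%N).
Hypotheses (c_gt0 : forall s, 0 < c s) (d_gt0 : 0 < d).
Hypotheses (h_ge0 : 0 <= h) (alpha_ge0 : 0 <= alpha).
Hypothesis PE : forall s, P / c s = (L s)%:R * d.

Local Notation vs := (value_slope e q c L h alpha).
Local Notation ns := (next_slope e q c L h alpha).

(** Both the target and [P / c s] are at least [d], so in each branch the level after transmission
    is at least [d]. *)
Lemma ystar_feasible n (x : R) s : 0 <= x -> d <= b n s ->
  feasible c P d x s (y n x s - x).
Proof.
move=> x0 db; rewrite /feasible /= mulrC -ler_pdivlMr// ge_max /ystar.
have dP : d <= P / c s by rewrite PE ler_peMl ?ler1n ?(ltW d_gt0).
have P0 : 0 <= P / c s by rewrite (le_trans (ltW d_gt0)).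
by have [?|?] := leP (b n s) x; [|have [?|?] := leP (b n s - P / c s) x];
  split; try (apply/andP; split); lra.
Qed.

Variable N : nat.
Hypothesis bE : forall n s, (1 <= n <= N)%N ->
  exists2 k, switch e q c L h alpha n s k & b n s = k.+1%:R * d.

Lemma bound_ge n s : (1 <= n <= N)%N -> d <= b n s.
Proof. by move=> /(bE s)[k _ ->]; rewrite ler_peMl ?ler1n ?(ltW d_gt0). Qed.

(** The target and [P / c s] are multiples of [d], so for each channel a whole cell falls under one
    case of [ystar]. Monotonicity of the slopes then shows that the minimum and maximum in the
    recursion select the slope of that case. *)
Lemma value_grid_affine n : (n <= N)%N -> grid_affine d (value n) (vs n).
Proof.
elim: n => [_ i x z _ _ _|n IH nN i x z ix xz zi] /=; first by rewrite subrr mul0r.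
have {}IH := IH (ltnW nN).
rewrite -sumrB mulr_suml; apply: eq_bigr => s _.
rewrite -mulrBr -mulrA; congr (_ * _).
have [k [klt kge] bk] := @bE n.+1 s nN.
rewrite /next_slope/= in klt kge.
have d0 := ltW d_gt0.
rewrite /ystar PE bk.
(* Cell at or above the target: nothing is sent, and playout moves cell [i] to cell [i - 1]. *)
have [ki|ik] := leqP k.+1 i.
  have kx : k.+1%:R * d <= x by apply: le_trans ix; rewrite ler_wpM2r// ler_nat.
  rewrite kx (le_trans kx xz).
  case: i => // i in ix zi ki *.
  rewrite max_r ?kge// min_r; last first.
    by rewrite lerD2l ler_wpM2l// value_slope_nondec// addSn leq_addr.
  have := IH i (x - d) (z - d).
  rewrite -[in i.+2%:R]natr1 -[in i.+1%:R]natr1 in ix zi *.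
  move=> /(_ _ _ _)-E; have {}E : value n (z - d) - value n (x - d) = vs n i * (z - x).
    by rewrite E; try lra; ring.
  by move: E => /(canRL (subrK _)) ->; ring.
have [kiL|iLk] := ltnP k (i + L s).
  (* Target within reach: the level after transmission is constant on the cell, which leaves the
     slope [- c s]. At [u = k.+1%:R * d] the first branch returns the target too. *)
  have yb u : i%:R * d <= u -> u <= i.+1%:R * d ->
     (if k.+1%:R * d <= u then u else
      if k.+1%:R * d - (L s)%:R * d <= u then k.+1%:R * d else u + (L s)%:R * d) = k.+1%:R * d.
    move=> iu ui; case: ifPn => ku.
      apply/eqP; rewrite eq_le ku andbT; apply: le_trans ui _.
      by rewrite ler_wpM2r// ler_nat.
    rewrite ifT//; apply: le_trans iu; rewrite -mulrBl ler_wpM2r//.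
    by rewrite lerBlDr -natrD ler_nat.
  rewrite !yb//; try lra.
  rewrite min_r.
    case: i ik {ix zi kiL yb} => [|i] ik; first by ring.
    by rewrite max_l; [ring|rewrite ltW// klt].
  apply: (le_trans (y := - c s)); last first.
    by rewrite kge// -ltnS prednK// (leq_ltn_trans _ kiL).
  case: i ik {ix zi kiL yb} => // i ik.
  by rewrite ge_max lexx ltW// klt.
have ltk : ((i + L s).-1 < k)%N by rewrite prednK// addn_gt0 L_gt0 orbT.
(* Target at best just reached: full power moves cell [i] to cell [i + L s - 1] after playout. If
   the target is met exactly, the middle branch gives the same level. *)
have yb u : i%:R * d <= u -> u <= i.+1%:R * d ->
   (if k.+1%:R * d <= u then u else
      if k.+1%:R * d - (L s)%:R * d <= u then k.+1%:R * d else u + (L s)%:R * d) = u + (L s)%:R * d.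
  move=> iu ui.
  have uk : u + (L s)%:R * d <= k.+1%:R * d.
    apply: le_trans (_ : (i.+1 + L s)%:R * d <= _).
      by rewrite natrD mulrDl lerD2r.
    by rewrite ler_wpM2r// ler_nat.
  have Ld : 0 < (L s)%:R * d by rewrite mulr_gt0// ltr0n.
  rewrite ifF; last by apply/negbTE; rewrite -ltNge; lra.
  by case: ifPn => // ?; lra.
rewrite !yb//; try lra.
rewrite min_l; last first.
  apply: (le_trans (ltW (klt _ ltk))).
  by case: (i) => // i'; rewrite le_max lexx.
have E : value n (z + (L s)%:R * d - d) - value n (x + (L s)%:R * d - d) =
    vs n (i + L s).-1 * (z - x).
  have [l lE] : exists l, L s = l.+1 by exists (L s).-1; rewrite prednK.
  move: (ix) (zi); rewrite lE addnS/= -[in l.+1%:R]natr1 -[in i.+1%:R]natr1 => ix' zi'.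
  rewrite (IH (i + l)%N); first by congr (_ * _); ring.
  - by rewrite natrD; lra.
  - by lra.
  - by rewrite -[in _.+1%:R]natr1 natrD; lra.
by move: E => /(canRL (subrK _)) ->; ring.
Qed.

Lemma ystar_optimal n (x : R) s z : (n < N)%N -> 0 <= x -> feasible c P d x s z ->
  let cost_after z := c s * z + h * (x + z - d) + alpha * value n (x + z - d) in
  cost_after (y n.+1 x s - x) <= cost_after z.
Proof.
move=> nN x0 [/= zge zle]; have d0 := d_gt0.
have [k [klt kge] bk] := @bE n.+1 s nN.
rewrite /next_slope/= in klt kge.
have fS := value_grid_affine (ltnW nN).
(* In terms of the level [t = x + z - d] after playout, [phi] differs from [cost_after] by the
   constant [c s * (x - d)]. It decreases weakly up to [k%:R * d] and increases weakly afterwards,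
   so each branch of [ystar] moves as close to [k%:R * d] as feasibility allows. *)
pose phi t := c s * t + h * t + alpha * value n t.
have phiS : grid_affine d phi (fun i => c s + (h + alpha * vs n i)).
  move=> i u v iu uv vi; rewrite /phi.
  by have := fS i u v iu uv vi => /(canRL (subrK _)) ->; ring.
have dec : forall u v, 0 <= u -> u <= v -> v <= k%:R * d -> phi v <= phi u.
  by apply: (grid_affine_noninc phiS) => i /klt; lra.
have inc : forall u v, k%:R * d <= u -> u <= v -> phi u <= phi v.
  by apply: (grid_affine_nondec d_gt0 phiS) => i /kge; lra.
suff : phi (y n.+1 x s - d) <= phi (x + z - d).
  rewrite /phi [x + (_ - x)]addrC subrK; lra.
move: zge; rewrite ge_max => /andP[z0 zd].
have {}zle : z <= (L s)%:R * d by rewrite -PE ler_pdivlMr// mulrC.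
have kd : 0 <= k%:R * d by rewrite mulr_ge0// ltW.
rewrite /ystar PE bk -natr1 mulrDl mul1r.
case: ifPn => [kx|]; first by apply: inc; lra.
rewrite -ltNge => xk; case: ifPn => [kLx|].
  have [le|/ltW le] := leP (k%:R * d) (x + z - d); first by apply: inc; lra.
  by apply: dec; lra.
by rewrite -ltNge => xkL; apply: dec; lra.
Qed.

Lemma value_ge0 n (x : R) : (n <= N)%N -> 0 <= x -> 0 <= value n x.
Proof.
elim: n x => [|n IH] x nN x0 /=; first exact: lexx.
apply: sumr_ge0 => s _; rewrite mulr_ge0//.
have [] := ystar_feasible x0 (@bound_ge n.+1 s nN).
rewrite /= ge_max => /andP[z0 zd] _.
have yd : 0 <= y n.+1 x s - d by lra.
by rewrite !addr_ge0// mulr_ge0// ?(ltW (c_gt0 s))// IH// ltnW.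
Qed.

End value.

(** * Iterated integration against the joint law *)

Section integral_joint.
Local Open Scope ereal_scope.
Context {d1 d2 : measure_display} {T1 : measurableType d1}
  {T2 : measurableType d2} {R : realType}.
Variables (mu : probability T1 R) (k : R.-pker T1 ~> T2).
Import HBNNSimple.

Let integral_section_measurable (f : T1 * T2 -> \bar R) :
  (forall z, 0 <= f z) -> measurable_fun [set: T1 * T2] f ->
  measurable_fun setT (fun x => \int[k x]_y f (x, y)).
Proof. exact: measurable_fun_integral_finite_kernel. Qed.

Let integral_joint_indic A : measurable A ->
  \int[joint_law mu k]_z (\1_A z)%:E = \int[mu]_x \int[k x]_y (\1_A (x, y))%:E.
Proof. by move=> mA; rewrite integral_indic ?setIT. Qed.

Let integral_joint_nnsfun (f : {nnsfun (T1 * T2)%type >-> R}) :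
  \int[joint_law mu k]_z (f z)%:E = \int[mu]_x \int[k x]_y (f (x, y))%:E.
Proof.
have mfr r : measurable_fun setT (fun z => (r * \1_(f @^-1` [set r]) z)%:E).
  by apply/measurable_EFinP/measurable_funM => //; exact: measurable_indic.
under [in LHS]eq_integral do rewrite fimfunE -fsumEFin//.
rewrite ge0_integral_fsum//; last by move=> r z _; rewrite EFinM nnfun_muleindic_ge0.
under [in RHS]eq_integral.
  move=> x _.
  under eq_integral do rewrite fimfunE -fsumEFin//.
  rewrite /= ge0_integral_fsum//; last 2 first.
    - by move=> r; apply: measurableT_comp (mfr r) _.
    - by move=> r z _; rewrite EFinM nnfun_muleindic_ge0.
  over.
rewrite /= ge0_integral_fsum//; last 2 first.
  - move=> r; apply: (integral_section_measurable (f := fun z => (r * \1_(f @^-1` [set r]) z)%:E)) => // z.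
    by rewrite EFinM nnfun_muleindic_ge0.
  - by move=> r x _; apply: integral_ge0 => y _; rewrite EFinM nnfun_muleindic_ge0.
apply: eq_fsbigr => r _.
have mfi : measurable (f @^-1` [set r]) by exact: measurable_funPTI.
(* Pulling [r] out of the integrals needs [0 <= r]; a negative [r] is not a value of [f], so its
   indicator vanishes. *)
have [r0|r0] := ltP r 0%R.
  have E z : (r * \1_(f @^-1` [set r]) z)%:E = 0.
    by rewrite preimage_nnfun0// indic0 mulr0.
  transitivity (0 : \bar R); [|apply/esym]; apply: integral0_eq => x _; first exact: E.
  by apply: integral0_eq => y _; exact: E.
under [in LHS]eq_integral do rewrite EFinM.
rewrite ge0_integralZl//; last exact/measurable_EFinP/measurable_indic.
rewrite integral_joint_indic// -ge0_integralZl//; last 2 first.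
- apply: (integral_section_measurable (f := fun z => (\1_(f @^-1` [set r]) z)%:E)) => //.
  exact/measurable_EFinP/measurable_indic.
- by move=> x _; exact: integral_ge0.
apply: eq_integral => x _; rewrite -ge0_integralZl//.
by apply: measurableT_comp => //; exact: measurableT_comp.
Qed.

(** For indicators this is the definition of [joint]. Linearity extends it to simple functions, and
    monotone convergence, in the inner and the outer integral, to nonnegative ones. *)
Lemma integral_joint (f : T1 * T2 -> \bar R) :
  (forall z, 0 <= f z) -> measurable_fun [set: T1 * T2] f ->
  \int[joint_law mu k]_z f z = \int[mu]_x \int[k x]_y f (x, y).
Proof.
move=> f0 mf; pose f_ := nnsfun_approx measurableT mf.
have mf_ n : measurable_fun setT (fun z => (f_ n z)%:E) by exact/measurable_EFinP.
have nd_f_ z : {homo (fun n => (f_ n z)%:E) : a b / (a <= b)%N >-> a <= b}.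
  by move=> a b ab; rewrite lee_fin; exact/lefP/nd_nnsfun_approx.
have f_cvg z : f z = limn (fun n => (f_ n z)%:E).
  by apply/esym/cvg_lim => //; exact: cvg_nnsfun_approx.
under eq_integral do rewrite f_cvg.
rewrite monotone_convergence//; last by move=> n z _; rewrite lee_fin.
under eq_fun do rewrite integral_joint_nnsfun.
rewrite -monotone_convergence//; last 3 first.
- by move=> n; apply: (integral_section_measurable (f := fun z => (f_ n z)%:E)) => // z;
    rewrite lee_fin.
- by move=> n x _; apply: integral_ge0 => y _; rewrite lee_fin.
- move=> x _ a b ab; apply: ge0_le_integral => //.
  + by move=> y _; rewrite lee_fin.
  + by apply: measurableT_comp (mf_ a) _.
  + by apply: measurableT_comp (mf_ b) _.
  + by move=> y _; exact: nd_f_.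
apply: eq_integral => x _; rewrite -monotone_convergence//.
- by apply: eq_integral => y _; rewrite f_cvg.
- by move=> n; apply: measurableT_comp (mf_ n) _.
- by move=> n y _; rewrite lee_fin.
Qed.

End integral_joint.

(** * Integration over a finite discrete space *)

Section finite_discrete.
Local Open Scope ereal_scope.
Context {dS : measure_display} {S : measurableType dS} {R : realType}.
Hypotheses (finS : finite_set [set: S]) (discS : forall A : set S, measurable A).
Variable p : probability S R.

Lemma discrete_measurable_fun d' (T : sigmaRingType d') (f : S -> T) :
  measurable_fun setT f.
Proof. by move=> _ Y mY; exact: discS. Qed.

Lemma integral_finite (f : S -> \bar R) : (forall s, 0 <= f s) ->
  \int[p]_s f s = \sum_(s <- fset_set [set: S]) p [set s] * f s.
Proof.
move=> f0; rewrite -fsbig_finite//=.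
transitivity (\int[p]_s \sum_(t \in [set: S]) (f t * (\1_[set t] s)%:E)).
  apply: eq_integral => s _.
  rewrite (fsbigD1 s)//=.
  rewrite indicE mem_set// mule1 fsbig1 ?adde0// => t [_ /= ts].
  by rewrite indicE memNset ?mule0// => st; apply: ts.
rewrite ge0_integral_fsum//; last 2 first.
- by move=> t; exact: discrete_measurable_fun.
- by move=> t s _; rewrite mule_ge0.
apply: eq_fsbigr => t _.
by rewrite ge0_integralZl// integral_indic ?setIT// muleC.
Qed.

End finite_discrete.

(** * The thresholds as negated slopes *)

Section thresholds.
Context {dS : measure_display} {S : measurableType dS} {R : realType}.
Variables (p : probability S R) (c : S -> R) (P d h alpha : R).
Hypotheses (finS : finite_set [set: S]) (discS : forall A : set S, measurable A).

Local Notation e := (fset_set [set: S]).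
Local Notation q := (fun s : S => fine (p [set s])).
Local Notation L := (L c P d).
Local Notation gamma := (gamma p c P d h alpha).
Local Notation ns := (next_slope e q c L h alpha).

Lemma prob_set1E s : p [set s] = (q s)%:E.
Proof. by rewrite fineK// fin_num_measure. Qed.

(** Finiteness is asked only on [A]: the first sum defining a threshold has an infinite summand over
    an empty set when the previous threshold is [+oo]. *)
Lemma fsum_EFin (A : S -> bool) (F : S -> \bar R) (g : S -> R) :
  (forall s, A s -> F s = (g s)%:E) ->
  (\sum_(s \in [set s | A s]) F s)%E = (\sum_(s <- e) if A s then g s else 0)%:E.
Proof.
move=> FE; rewrite fsbig_mkcond -sumEFin -(fsbig_finite _ _ finS)/=.
apply: eq_fsbigr => s _; rewrite patchE.
by have [As|As] := boolP (A s); [rewrite mem_set ?FE|rewrite memNset//; exact/negP].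
Qed.

Hypotheses (c_gt0 : forall s, 0 < c s) (L_gt0 : forall s, (0 < L s)%N).
Hypotheses (h_ge0 : 0 <= h) (alpha_ge0 : 0 <= alpha).

Let q_ge0 s : 0 <= q s. Proof. by rewrite fine_ge0. Qed.

(* For i + 2 > n the threshold is truncated to 0 while the slope is
   nonnegative, so both sides are false because c s > 0. *)
Let gamma_gt_of n i s :
  gamma n i.+2 = (if (i.+2 <= n)%N then (- ns n i)%:E else 0%E) ->
  ((c s)%:E < gamma n i.+2)%E = (ns n i < - c s).
Proof.
move=> ->; case: ifPn => [_|]; first by rewrite lte_fin ltrNr.
rewrite -ltnNge ltnS => ni; rewrite lte_fin.
have a0 : 0 <= ns n i by rewrite next_slope_ge0.
have cs := c_gt0 s; apply/idP/idP; lra.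
Qed.

(** Let [M] be the second argument of the minimum in the slope recursion and [a] the first. The
    first two sums of the threshold recursion contribute [- M] per channel, and the third
    contributes the excess of [- a] over [c s], if positive; together they give [- Num.min a M]. *)
Lemma gammaE n i :
  gamma n i.+2 = if (i.+2 <= n)%N then (- ns n i)%:E else 0%E.
Proof.
elim: n i => [//|n IH] i; rewrite [LHS]/= ltnNge.
case: ifPn => [/negbTE->//|/negPn ni]; rewrite ni.
have gtE j s := gamma_gt_of s (IH j).
have iL s : (i.+1 + L s)%N = (i + L s).-1.+2.
  by rewrite addSn prednK// addn_gt0 L_gt0 orbT.
pose g3 s := if ns n (i + L s).-1 < - c s
  then q s * (- ns n (i + L s).-1 - c s) else 0.
have -> : (\sum_(s \in [set s | ((c s)%:E < gamma n (i.+1 + L s))%E])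
    (p [set s] * (gamma n (i.+1 + L s) - (c s)%:E)))%E = (\sum_(s <- e) g3 s)%:E.
  rewrite (_ : mkset _ = [set s | ns n (i + L s).-1 < - c s]); last first.
    by apply: eq_set => s; rewrite iL gtE.
  apply: fsum_EFin => s As; rewrite iL prob_set1E IH; case: ifPn => [//|].
  rewrite -ltnNge ltnS => nj; move: As.
  have := @next_slope_ge0 _ _ e q c L h alpha q_ge0 h_ge0 alpha_ge0 _ _ nj.
  by move=> a0 /(le_lt_trans a0); rewrite oppr_gt0 ltNge (ltW (c_gt0 s)).
suff [g1 [g2 [-> -> E]]] : exists g1 g2, [/\
    (\sum_(s \in [set s | (gamma n i.+1 <= (c s)%:E)%E]) (p [set s] * gamma n i.+1))%E
      = (\sum_(s <- e) g1 s)%:E,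
    (\sum_(s \in [set s | ((c s)%:E < gamma n i.+1)%E]) (p [set s] * (c s)%:E))%E
      = (\sum_(s <- e) g2 s)%:E &
    forall s, g1 s + g2 s = - (q s * (if i is i'.+1 then Num.max (- c s) (ns n i')
         else - c s))].
  transitivity ((- h + alpha *
    (\sum_(s <- e) g1 s + \sum_(s <- e) g2 s + \sum_(s <- e) g3 s))%:E); first by [].
  congr EFin; rewrite /next_slope opprD -mulrN; congr (_ + _ * _).
  rewrite -big_split -big_split/=.
  case: n ni {IH gtE} @g3 E => // n _ g3 E.
  rewrite value_slopeS -sumrN; apply: eq_bigr => s _; rewrite {}E /g3.
  set M := (if i is _.+1 then _ else _).
  set a := next_slope _ _ _ _ _ _ _ (i + L s).-1.
  have cM : - c s <= M by rewrite /M; case: (i) => // i'; rewrite le_max lexx.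
  (* By monotonicity of the slopes, [a < - c s] forces [M = - c s], so the third sum supplies
     exactly [M - a]. *)
  have Ma : M <= Num.max (- c s) a.
    rewrite /M /a; case: (i) => [|i']; first by rewrite le_max lexx.
    by rewrite ge_max !le_max lexx next_slope_nondec ?orbT// addSn leq_addr.
  have [ac|ac] := ltP a (- c s).
    rewrite min_l ?(le_trans (ltW ac))//.
    have -> : M = - c s by apply/le_anti; rewrite cM (le_trans Ma)// max_l// ltW.
    ring.
  by rewrite min_r ?addr0// (le_trans Ma)// max_r.
(* For [i = 0] the previous threshold is [+oo]: the first sum is empty and the second runs over all
   channels, matching the value [- c s] in the slope recursion. *)
case: i ni {iL g3} => [|i] ni.
  have g1 : gamma n 1 = +oo%E by case: (n).
  exists (fun=> 0), (fun s => q s * c s); split.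
  - rewrite g1 (_ : mkset _ = [set s | xpred0 s]); last first.
      by apply: eq_set => s; rewrite leye_eq.
    exact: (fsum_EFin (g := fun=> 0)).
  - rewrite g1 (_ : mkset _ = [set s | xpredT s]); last first.
      by apply: eq_set => s; rewrite ltry.
    by apply: fsum_EFin => s _; rewrite prob_set1E.
  - by move=> s; rewrite add0r mulrN opprK.
have gi : gamma n i.+2 = (- ns n i)%:E by rewrite IH -ltnS ni.
exists (fun s => if - ns n i <= c s then q s * - ns n i else 0).
exists (fun s => if c s < - ns n i then q s * c s else 0).
split.
- rewrite gi; apply: fsum_EFin => s _; by rewrite prob_set1E.
- rewrite gi; apply: fsum_EFin => s _; by rewrite prob_set1E.
- move=> s; case: (leP (- ns n i) (c s)) => ac.
    by rewrite max_r 1?lerNl// addr0 mulrN.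
  by rewrite max_l 1?lerNr 1?ltW// add0r mulrN opprK.
Qed.

Lemma gamma_gt n i s : ((c s)%:E < gamma n i.+2)%E = (ns n i < - c s).
Proof. exact: gamma_gt_of (gammaE n i). Qed.

(** The two inequalities of a band locate [- c s] between the slopes on either side of index [k];
    monotonicity extends them to all indices. For [k = 0] the upper one holds since
    [gamma n 1 = +oo]. *)
Lemma in_band_switch n s k :
  in_band p c P d h alpha n s k.+1 <-> switch e q c L h alpha n s k.
Proof.
have mono i j : (i <= j)%N -> ns n i <= ns n j by exact: next_slope_nondec.
rewrite /in_band leNgt gamma_gt -leNgt; split=> [[_ /andP[kc ck]]|[lt ge]].
  split=> i ik; last exact: le_trans (mono _ _ ik).
  case: k ck ik {kc} => // k; rewrite gamma_gt ltnS => ck ik.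
  exact: le_lt_trans (mono _ _ ik) ck.
split=> //; rewrite ge//=.
case: k lt {ge} => [_|k lt].
  by rewrite [gamma _ _](_ : _ = +oo%E) ?ltry//; case: (n).
by rewrite gamma_gt lt.
Qed.

End thresholds.

(** * Measurability of costs and constraints, and the policy induced by [y*] *)

Section measurability.
Context {dS : measure_display} {S : measurableType dS} {R : realType}.
Hypothesis discS : forall A : set S, measurable A.
Variables (c : S -> R) (P d h alpha : R) (b : nat -> S -> R).

Local Notation mfunS := (discrete_measurable_fun discS).

Lemma measurable_buffer k : measurable_fun setT (@buffer dS S R d k).
Proof.
elim: k => [|k IH] /=; first exact: measurable_cst.
apply: measurable_funB; last exact: measurable_cst.
apply: measurable_funD; last exact: measurable_snd.
by apply: measurableT_comp => //; apply: measurableT_comp.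
Qed.

Lemma measurable_cost k : measurable_fun setT (@cost dS S R c d h alpha k).
Proof.
elim: k => [|k IH] /=; first exact: measurable_cst.
rewrite (_ : (fun w => _) = (fun w : hist S R k * S * R => cost c d h alpha w.1.1 +
   alpha ^+ k * (c w.1.2 * w.2 + h * (buffer d w.1.1 + w.2 - d)))); last first.
  by apply/funext => -[[]].
have m1 : measurable_fun setT (fun w : hist S R k * S * R => w.1.1).
  by apply: measurableT_comp.
have m2 : measurable_fun setT (fun w : hist S R k * S * R => c w.1.2).
  by apply: measurableT_comp (mfunS c) _; apply: measurableT_comp.
have mb := measurableT_comp (@measurable_buffer k) m1.
apply: measurable_funD; first exact: measurableT_comp IH m1.
apply: measurable_funM => //; apply: measurable_funD; first exact: measurable_funM.
by apply: measurable_funM => //; apply: measurable_funB => //; apply: measurable_funD.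
Qed.

Lemma measurable_feasible_hist k : measurable [set w | @feasible_hist dS S R c P d k w].
Proof.
elim: k => [|k IH] /=; first exact: measurableT.
have m1 : measurable_fun setT (fun w : hist S R k * S * R => w.1.1).
  by apply: measurableT_comp.
have m2 : measurable_fun setT (fun w : hist S R k * S * R => c w.1.2).
  by apply: measurableT_comp (mfunS c) _; apply: measurableT_comp.
have mb := measurableT_comp (@measurable_buffer k) m1.
have mle1 : measurable_fun setT (fun w : hist S R k * S * R =>
    Num.max 0 (d - buffer d w.1.1) <= w.2).
  apply: measurable_fun_ler => //; apply: measurable_maxr => //.
  exact: measurable_funB.
have mle2 : measurable_fun setT (fun w : hist S R k * S * R => c w.1.2 * w.2 <= P).
  by apply: measurable_fun_ler => //; apply: measurable_funM.
rewrite (_ : mkset _ =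
  (fun w : hist S R k * S * R => w.1.1) @^-1` [set w | feasible_hist c P d w] `&`
  ((fun w : hist S R k * S * R => Num.max 0 (d - buffer d w.1.1) <= w.2)
     @^-1` [set true] `&`
   (fun w : hist S R k * S * R => c w.1.2 * w.2 <= P) @^-1` [set true]))//.
apply: measurableI; first by rewrite -[X in measurable X]setTI; exact: m1.
by apply: measurableI; rewrite -[X in measurable X]setTI; [exact: mle1|exact: mle2].
Qed.

Lemma measurable_ystar d' (T : measurableType d') n (x : T -> R) (s : T -> S) :
  measurable_fun setT x -> measurable_fun setT s ->
  measurable_fun setT (fun t => ystar c P b n (x t) (s t)).
Proof.
move=> mx ms.
have mb : measurable_fun setT (fun t => b n (s t)) by exact: measurableT_comp (mfunS _) ms.
have mP : measurable_fun setT (fun t => P / c (s t)).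
  by exact: measurableT_comp (mfunS (fun s => P / c s)) ms.
apply: measurable_fun_ifT => //; first exact: measurable_fun_ler.
apply: measurable_fun_ifT => //; last exact: measurable_funD.
by apply: measurable_fun_ler => //; exact: measurable_funB.
Qed.

Lemma measurable_value (e : seq S) (q : S -> R) n :
  measurable_fun setT (value e q c P d h alpha b n).
Proof.
elim: n => [|n IH] /=; first exact: measurable_cst.
apply: measurable_sum => s; apply: measurable_funM => //.
have my : measurable_fun setT (fun x => ystar c P b n.+1 x s).
  exact: measurable_ystar.
have myd : measurable_fun setT (fun x => ystar c P b n.+1 x s - d) by exact: measurable_funB.
apply: measurable_funD; last first.
  by apply: measurable_funM => //; exact: measurableT_comp myd.
by apply: measurable_funD; apply: measurable_funM => //; exact: measurable_funB.
Qed.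

Variable N : nat.

Let measurable_decision k : measurable_fun setT
  (fun ws : hist S R k * S =>
    ystar c P b (N - k) (buffer d ws.1) ws.2 - buffer d ws.1).
Proof.
have mb : measurable_fun setT (fun ws : hist S R k * S => buffer d ws.1).
  by apply: measurableT_comp (@measurable_buffer k) _.
by apply: measurable_funB => //; exact: measurable_ystar.
Qed.

Definition ystar_policy : policy S R := fun k => kdirac (@measurable_decision k).

Lemma ystar_policyE k w s : ystar_policy k (w, s) =
  \d_(ystar c P b (N - k) (buffer d w) s - buffer d w) :> (set R -> \bar R).
Proof. by []. Qed.

Lemma ystar_policy_follows : follows d N ystar_policy (ystar c P b).
Proof. by move=> k w s _; rewrite ystar_policyE diracE mem_set. Qed.

End measurability.

(** * Verification of optimality on histories *)

Section dynamic_programming.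
Context {dS : measure_display} {S : measurableType dS} {R : realType}.
Variables (p : probability S R) (c : S -> R) (P d h alpha : R) (N : nat).
Hypotheses (finS : finite_set [set: S]) (discS : forall A : set S, measurable A).

Local Notation e := (fset_set [set: S]).
Local Notation q := (fun s : S => fine (p [set s])).
Local Notation L := (L c P d).
Local Notation feas := (@feasible_hist dS S R c P d).

Lemma sum_prob_set1 : (\sum_(s <- e) p [set s])%E = 1%E.
Proof.
rewrite -(probability_setT p) -[in LHS](eq_bigr _ (fun s _ => mule1 _)).
rewrite -(integral_finite finS discS p (fun=> lee01)).
by rewrite integral_cst// mul1e.
Qed.

Lemma integral_law_succ (pi : policy S R) k (f : hist S R k.+1 -> \bar R) :
  (forall w, (0 <= f w)%E) -> measurable_fun setT f ->
  (\int[law p pi k.+1]_w f w =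
   \int[law p pi k]_w \sum_(s <- e) p [set s] * \int[pi k (w, s)]_z f (w, s, z))%E.
Proof.
move=> f0 mf; rewrite [LHS]integral_joint//.
have mF : measurable_fun setT (fun ws => \int[pi k ws]_z f (ws, z))%E.
  exact: measurable_fun_integral_finite_kernel.
rewrite fubini_tonelli1//; last by move=> ws; apply: integral_ge0.
apply: eq_integral => w _; rewrite /fubini_F integral_finite// => s.
exact: integral_ge0.
Qed.

Hypotheses (c_gt0 : forall s, 0 < c s) (d_gt0 : 0 < d).
Hypotheses (h_ge0 : 0 <= h) (alpha_ge0 : 0 <= alpha).

Lemma measurable_feasible x s : measurable (feasible c P d x s).
Proof.
rewrite (_ : feasible _ _ _ _ _ = [set` `[Num.max 0 (d - x), P / c s]])//.
apply/seteqP; split=> z; rewrite /feasible /= in_itv/= ler_pdivlMr// [z * _]mulrC.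
  by move=> [-> ->].
by move=> /andP[].
Qed.

(** Writes a constant as an integral supported on feasible decisions, so that it can be compared
    pointwise with an integrand controlled only there. *)
Lemma integral_feasible (pi : policy S R) k (w : hist S R k) s (r : R) :
  admissible c P d N pi -> (k < N)%N -> feas w -> 0 <= r ->
  (\int[pi k (w, s)]_z
    (r * \1_[set w | feas w] ((w, s, z) : hist S R k.+1))%:E = r%:E)%E.
Proof.
move=> piP kN fw r0.
under eq_integral => z _.
  rewrite (_ : \1_ _ _ = \1_(feasible c P d (buffer d w) s) z); last first.
    rewrite !indicE; congr (_ %:R); apply: congr1.
    apply/idP/idP => [/set_mem|/set_mem zf]; last by apply: mem_set; exact: conj fw zf.
    by move=> [_ zf]; exact: mem_set.
  rewrite EFinM.
  over.
have mf := @measurable_feasible (buffer d w) s.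
rewrite ge0_integralZl//; last exact/measurable_EFinP/measurable_indic.
by rewrite integral_indic// setIT; rewrite piP// mule1.
Qed.

Lemma law_feasible (pi : policy S R) k : admissible c P d N pi -> (k <= N)%N ->
  law p pi k [set w | feas w] = 1%E.
Proof.
move=> piP; elim: k => [_|k IH kN]; first by rewrite /= diracE mem_set.
have mfeas j := measurable_feasible_hist discS c P d j.
transitivity (\int[law p pi k.+1]_w (\1_[set w | feas w] w)%:E)%E.
  by rewrite integral_indic ?setIT.
rewrite integral_law_succ//; last exact/measurable_EFinP/measurable_indic.
rewrite -(IH (ltnW kN)).
transitivity (\int[law p pi k]_w (\1_[set w | feas w] w)%:E)%E; last first.
  by rewrite integral_indic ?setIT.
apply: eq_integral => w _.
rewrite -[RHS]mul1e -sum_prob_set1 ge0_sume_distrl//.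
apply: eq_bigr => s _; congr (_ * _)%E.
have [fw|nfw] := pselect (feas w).
  rewrite [in RHS]indicE mem_set// -(integral_feasible s piP kN fw ler01).
  by apply: eq_integral => z _; rewrite mul1r.
rewrite [in RHS]indicE memNset// integral0_eq// => z _.
by rewrite indicE memNset// => -[].
Qed.

Lemma buffer_ge0 k (w : hist S R k) : feas w -> 0 <= buffer d w.
Proof.
case: k w => [|k] w; first by rewrite /= lexx.
by case=> _ [/=]; rewrite ge_max => /andP[_]; lra.
Qed.

Lemma cost_ge0 k (w : hist S R k) : feas w -> 0 <= cost c d h alpha w.
Proof.
elim: k w => [|k IH]; first by move=> w _ /=; exact: lexx.
move=> [[w s] z] fw; have := buffer_ge0 fw; case: fw => /= fw [+ _].
rewrite ge_max => /andP[z0 _] b0.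
by rewrite addr_ge0 ?IH// mulr_ge0 ?exprn_ge0// addr_ge0// mulr_ge0// ltW.
Qed.

Hypotheses (PE : forall s, P / c s = (L s)%:R * d) (L_gt0 : forall s, (0 < L s)%N).
Variable b : nat -> S -> R.
Hypothesis bE : forall n s, (1 <= n <= N)%N ->
  exists2 k, switch e q c L h alpha n s k & b n s = k.+1%:R * d.

Local Notation V := (value e q c P d h alpha b).
Local Notation y := (ystar c P b).

Let q_ge0 s : 0 <= q s. Proof. by rewrite fine_ge0. Qed.

(* Vanishing on infeasible histories makes it nonnegative, so that integrals can be
   iterated without integrability conditions. *)
Definition total k (w : hist S R k) : R :=
  (cost c d h alpha w + alpha ^+ k * V (N - k) (buffer d w)) * \1_[set w | feas w] w.

Lemma total_ge0 k (w : hist S R k) : (k <= N)%N -> 0 <= total w.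
Proof.
move=> kN; rewrite /total indicE; case: (pselect (feas w)) => [fw|nfw]; last first.
  by rewrite memNset// mulr0.
rewrite mem_set// mulr1 addr_ge0 ?cost_ge0// mulr_ge0 ?exprn_ge0//.
exact: (value_ge0 q_ge0 L_gt0 c_gt0 d_gt0 h_ge0 alpha_ge0 PE bE (leq_subr _ _)
  (buffer_ge0 fw)).
Qed.

Lemma measurable_total k : measurable_fun setT (@total k).
Proof.
apply: measurable_funM; last exact/measurable_indic/measurable_feasible_hist.
apply: measurable_funD; first exact: measurable_cost.
apply: measurable_funM => //.
exact: measurableT_comp (measurable_value discS c P d h alpha b e q (N - k))
  (@measurable_buffer _ _ _ d k).
Qed.

Lemma total_succ k (w : hist S R k) s z : (k < N)%N -> feas w ->
  feasible c P d (buffer d w) s z ->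
  total ((w, s, z) : hist S R k.+1) = cost c d h alpha w + alpha ^+ k *
    (c s * z + h * (buffer d w + z - d) + alpha * V (N - k.+1) (buffer d w + z - d)).
Proof.
move=> kN fw fz; rewrite /total indicE mem_set; last exact: conj fw fz.
by rewrite mulr1 exprSr /=; ring.
Qed.

(** The martingale identity for [y*]: it unfolds one step of [value], using that the channel
    probabilities sum to 1. *)
Lemma total_average k (w : hist S R k) : (k < N)%N -> feas w ->
  ((total w)%:E = \sum_(s <- e) p [set s] *
    (total ((w, s, y (N - k) (buffer d w) s - buffer d w) : hist S R k.+1))%:E)%E.
Proof.
move=> kN fw; have b0 := buffer_ge0 fw.
under eq_bigr => s _.
  rewrite total_succ//; last first.
    apply: (ystar_feasible L_gt0) => //; apply: (bound_ge d_gt0 bE).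
    by rewrite subn_gt0 kN leq_subr.
  rewrite prob_set1E// -EFinM mulrDr.
  over.
rewrite sumEFin; congr EFin.
rewrite big_split/= -mulr_suml /total indicE mem_set// mulr1.
have -> : \sum_(s <- e) q s = 1.
  apply: EFin_inj; rewrite -sumEFin -sum_prob_set1.
  by apply: eq_bigr => s _; rewrite -prob_set1E.
rewrite mul1r; congr (_ + _).
rewrite -(subnSK kN) /= mulr_sumr; apply: eq_bigr => s _.
by rewrite [in RHS]mulrCA [buffer d w + (_ - _)]addrC subrK.
Qed.

(** The submartingale inequality. On a feasible history each channel's term for [y*] is compared
    with every feasible [z] by [ystar_optimal]; infeasible [z] have probability zero. *)
Lemma total_le k (w : hist S R k) (pi : policy S R) : admissible c P d N pi ->
  (k < N)%N ->
  ((total w)%:E <= \sum_(s <- e) p [set s] *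
    \int[pi k (w, s)]_z (total ((w, s, z) : hist S R k.+1))%:E)%E.
Proof.
move=> piP kN; have [fw|nfw] := pselect (feas w); last first.
  rewrite /total indicE memNset// mulr0.
  apply: sume_ge0 => s _; apply: mule_ge0 => //; apply: integral_ge0 => z _.
  by rewrite lee_fin; exact: (@total_ge0 k.+1).
have b0 := buffer_ge0 fw.
rewrite total_average//; apply: lee_sum => s _; rewrite lee_wpmul2l//.
set zs := y _ _ s - _.
have fs : feasible c P d (buffer d w) s zs.
  apply: (ystar_feasible L_gt0) => //; apply: (bound_ge d_gt0 bE).
  by rewrite subn_gt0 kN leq_subr.
rewrite -(integral_feasible s piP kN fw); last exact: total_ge0.
have mt := @measurable_total k.+1.
have mfeas := measurable_feasible_hist discS c P d k.+1.
have mpair : measurable_fun setT (fun z : R => (w, s, z)) by exact: measurable_fun_pair.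
apply: ge0_le_integral => //.
- move=> z _; rewrite lee_fin mulr_ge0//; exact: (@total_ge0 k.+1).
- apply/measurable_EFinP; apply: measurable_funM => //.
  exact: measurableT_comp (measurable_indic mfeas) mpair.
- apply/measurable_EFinP; exact: measurableT_comp mt mpair.
move=> z _; rewrite lee_fin indicE.
have [fz|nfz] := pselect (feasible c P d (buffer d w) s z); last first.
  rewrite memNset ?mulr0; first exact: (@total_ge0 k.+1).
  by move=> [].
rewrite mem_set ?mulr1; last exact: conj fw fz.
rewrite !total_succ// lerD2l ler_wpM2l ?exprn_ge0// /zs -(subnSK kN).
have nN : (N - k.+1 < N)%N by rewrite subnSK// leq_subr.
exact: (ystar_optimal q_ge0 L_gt0 c_gt0 d_gt0 alpha_ge0 PE bE nN b0 fz).
Qed.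

Let total_succ_eint (pi : policy S R) k : (k < N)%N ->
  (\int[law p pi k.+1]_w (total w)%:E =
   \int[law p pi k]_w \sum_(s <- e) p [set s] *
     \int[pi k (w, s)]_z (total ((w, s, z) : hist S R k.+1))%:E)%E.
Proof.
move=> kN; rewrite integral_law_succ//.
- by move=> w; rewrite lee_fin total_ge0.
- exact/measurable_EFinP/measurable_total.
Qed.

Lemma integral_total_le (pi : policy S R) k : admissible c P d N pi -> (k < N)%N ->
  (\int[law p pi k]_w (total w)%:E <= \int[law p pi k.+1]_w (total w)%:E)%E.
Proof.
move=> piP kN; rewrite total_succ_eint//.
apply: ge0_le_integral => //.
- by move=> w _; rewrite lee_fin total_ge0 1?ltnW.
- exact/measurable_EFinP/measurable_total.
- apply: emeasurable_sum => s; apply: measurable_funeM.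
  have mt : measurable_fun setT (fun w : hist S R k.+1 => (total w)%:E).
    exact/measurable_EFinP/measurable_total.
  pose f (ws : hist S R k * S) :=
    (\int[pi k ws]_z (total ((ws, z) : hist S R k.+1))%:E)%E.
  have mf : measurable_fun setT f.
    apply: (measurable_fun_integral_finite_kernel
      (fun w => (total (w : hist S R k.+1))%:E)).
      by move=> w; rewrite lee_fin (@total_ge0 k.+1).
    exact: mt.
  by apply: (measurableT_comp mf); exact: measurable_fun_pair.
- by move=> w _; exact: total_le.
Qed.

Lemma integral_total_ystar k : (k < N)%N -> let pi := ystar_policy discS c P d b N in
  (\int[law p pi k]_w (total w)%:E = \int[law p pi k.+1]_w (total w)%:E)%E.
Proof.
move=> kN pi; rewrite total_succ_eint//; apply: eq_integral => w _.
under eq_bigr => s _.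
  rewrite /pi ystar_policyE integral_dirac//; last first.
    apply/measurable_EFinP; apply: measurableT_comp (@measurable_total k.+1) _.
    exact: measurable_fun_pair.
  rewrite diracT mul1e.
  over.
have [fw|nfw] := pselect (feas w); first exact: total_average.
rewrite [in LHS]/total indicE memNset// mulr0 big1// => s _.
by rewrite /total indicE memNset ?mulr0 ?mule0// => -[].
Qed.

(** At [k = N] no cost-to-go remains, and the indicator in [total] equals 1 almost surely under an
    admissible policy. *)
Lemma expected_cost_total (pi : policy S R) : admissible c P d N pi ->
  expected_cost p c d h alpha N pi = (\int[law p pi N]_w (total w)%:E)%E.
Proof.
move=> piP; rewrite /expected_cost unlock.
apply: ae_eq_integral => //.
- exact/measurable_EFinP/measurable_cost.
- exact/measurable_EFinP/measurable_total.
have mfeas := measurable_feasible_hist discS c P d N.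
exists (~` [set w | feas w]); split; first exact: measurableC.
- by have := probability_setC (law p pi N) mfeas; rewrite law_feasible// subee.
- move=> w /= nfw fw; apply: nfw => _.
  by rewrite /total subnn /= mulr0 addr0 indicE mem_set// mulr1.
Qed.

Lemma ystar_policy_admissible : admissible c P d N (ystar_policy discS c P d b N).
Proof.
move=> k w s kN fw; rewrite ystar_policyE diracE mem_set//.
apply: (ystar_feasible L_gt0) => //; first exact: buffer_ge0.
by apply: (bound_ge d_gt0 bE); rewrite subn_gt0 kN leq_subr.
Qed.

(** All policies start from the same [total] at the empty history. Through the [N] slots its
    expectation cannot decrease under an admissible policy and stays constant under [y*]. *)
Lemma ystar_policy_optimal : optimal p c P d h alpha N (ystar_policy discS c P d b N).
Proof.
have adm := ystar_policy_admissible.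
split=> // pi piP; rewrite !expected_cost_total//.
have total0 (pi' : policy S R) :
    (\int[law p pi' 0]_w (total w)%:E = (total (tt : hist S R 0))%:E)%E.
  by rewrite integral_dirac ?diracT ?mul1e//; exact/measurable_EFinP/measurable_total.
have lower k : (k <= N)%N ->
    ((total (tt : hist S R 0))%:E <= \int[law p pi k]_w (total w)%:E)%E.
  elim: k => [|k IH] kN; first by rewrite total0.
  by apply: le_trans (integral_total_le piP kN); exact/IH/ltnW.
have attained k : (k <= N)%N ->
    (\int[law p (ystar_policy discS c P d b N) k]_w (total w)%:E =
     (total (tt : hist S R 0))%:E)%E.
  elim: k => [|k IH] kN; first by rewrite total0.
  by rewrite -integral_total_ystar// IH// ltnW.
by rewrite attained// lower.
Qed.

End dynamic_programming.

(** * Exactness of the truncation in [L], and the final assembly *)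

Lemma power_multiple (R : realType) (dS : measure_display) (S : measurableType dS)
    (c : S -> R) (P d : R) (s : S) : 0 < c s -> 0 < d ->
  (exists l : nat, (0 < l)%N /\ P / c s = l%:R * d) ->
  (0 < L c P d s)%N /\ P / c s = (L c P d s)%:R * d.
Proof.
move=> c0 d0 [l [l0 lE]].
suff -> : L c P d s = l by [].
by rewrite /L invfM mulrCA mulrC lE mulfK ?gt_eqF// natrK.
Qed.

Theorem theorem2 (R : realType) (dS : measure_display) (S : measurableType dS)
    (finS : finite_set [set: S]) (discS : forall A : set S, measurable A)
    (p : probability S R) (c : S -> R) (P d h alpha : R) (N : nat)
    (c_gt0 : forall s, 0 < c s) (P_gt0 : 0 < P) (d_gt0 : 0 < d)
    (h_ge0 : 0 <= h) (alpha01 : 0 <= alpha <= 1) (N_gt0 : (0 < N)%N)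
    (P_mult : forall s, exists l : nat, (0 < l)%N /\ P / c s = l%:R * d) :
  (forall (n : nat) (s : S), (1 <= n <= N)%N ->
     exists! j : nat, in_band p c P d h alpha n s j) /\
  (forall b : nat -> S -> R,
     (forall (n : nat) (s : S) (j : nat), (1 <= n <= N)%N ->
        in_band p c P d h alpha n s j -> b n s = j%:R * d) ->
     exists pi : policy S R,
       follows d N pi (ystar c P b) /\
       optimal p c P d h alpha N pi).
Proof.
have [PE L_gt0] : (forall s, P / c s = (L c P d s)%:R * d) /\
    (forall s, (0 < L c P d s)%N).
  by split=> s; have [] := power_multiple (c_gt0 s) d_gt0 (P_mult s).
have /andP[alpha_ge0 _] := alpha01.
have q_ge0 s : 0 <= fine (p [set s]) by rewrite fine_ge0.
pose e : seq S := fset_set [set: S].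
have bandE := in_band_switch p finS discS c_gt0 L_gt0 h_ge0 alpha_ge0.
have band_ex n s : exists k, in_band p c P d h alpha n s k.+1.
  have [k kP] := switch_exists e (L c P d) q_ge0 h_ge0 alpha_ge0 n (c_gt0 s).
  by exists k; apply/bandE; exact: kP.
split=> [n s _|b bE].
  (* The clause [1 <= j] of [in_band] excludes the junk index 0; for the others, uniqueness is that
     of the crossing index. *)
  have [k kP] := band_ex n s; exists k.+1; split=> // -[[]//|k' k'P].
  by congr _.+1; apply: switch_uniq; apply/bandE; [exact: kP|exact: k'P].
have b_switch n s : (1 <= n <= N)%N -> exists2 k,
    switch e (fun s => fine (p [set s])) c (L c P d) h alpha n s k & b n s = k.+1%:R * d.
  by move=> nN; have [k kP] := band_ex n s; exists k; [exact/bandE|exact: bE].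
exists (ystar_policy discS c P d b N); split; first exact: ystar_policy_follows.
exact: ystar_policy_optimal.
Qed.
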